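(* Let $\sum_{n=1}^\infty x_n$ be an absolutely convergent series of real numbers. Then its set of uniqueness $U=U(x_n)$ is a $\mathcal G_\delta$ subset of $\mathbb R$ (a countable intersection of open sets).
   Context: $\mathbb N=\{1,2,3,\dots\}$. For an absolutely convergent series $\sum x_n$ of real numbers, the achievement set is $E(x_n)=\{y\in\mathbb R:\ \exists A\subset\mathbb N,\ y=\sum_{n\in A}x_n\}$ (the empty sum is $0$), and the set of subsums with unique representation (set of uniqueness) is $U(x_n)=\{x\in E(x_n):\ \text{there is exactly one } A\subset\mathbb N \text{ with } x=\sum_{n\in A}x_n\}$. *)

(* Defs.v *)
From HB Require Import structures.
From mathcomp Require Import all_boot all_order all_algebra.
From mathcomp Require Import all_classical all_reals all_analysis.
From mathcomp Require Import borel_hierarchy.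

Set Implicit Arguments.
Unset Strict Implicit.
Unset Printing Implicit Defensive.

Import Order.TTheory GRing.Theory Num.Theory.
Import numFieldNormedType.Exports.
Local Open Scope classical_set_scope.
Local Open Scope ring_scope.

(* Sequences are indexed from 0, so the series
   x_1 + x_2 + ... over {1, 2, ...} is given by [x 0 = x_1], [x 1 = x_2], ...;
   subsets of {1, 2, ...} are shifted to subsets of [nat] accordingly. *)

(* [y] is the sum of [x n] over [n] in [A], summed in increasing order of the
   indices; the order is immaterial for absolutely convergent series. *)
Definition is_subsum (R : realType) (x : R^nat) (A : set nat) (y : R) : Prop :=
  \sum_(0 <= k < n | k \in A) x k @[n --> \oo] --> y.

Definition achievement_set (R : realType) (x : R^nat) : set R :=
  [set y | exists A : set nat, is_subsum x A y].

Definition uniqueness_set (R : realType) (x : R^nat) : set R :=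
  [set y | achievement_set x y /\ exists! A : set nat, is_subsum x A y].

(* Main.v *)
(* The subsum map from the Cantor space {0,1}^N is continuous, because the
   tails of the series are uniformly small.  Hence, for every k, the set of
   subsums that use x k and the set of subsums that avoid x k are both compact,
   and so is their union, the achievement set E.  A point of E has two
   representations iff, for some k, it lies in the intersection D_k of those two
   sets.  So U = E \ (D_0 u D_1 u ...), where E is closed, thus G_delta, and
   each D_k is closed. *)

Require Import Defs.
From HB Require Import structures.
From mathcomp Require Import all_boot all_order all_algebra.
From mathcomp Require Import all_classical all_reals all_analysis.
From mathcomp Require Import borel_hierarchy.
From mathcomp Require Import ring.

Set Implicit Arguments.
Unset Strict Implicit.
Unset Printing Implicit Defensive.

Import Order.TTheory GRing.Theory Num.Theory.
Import numFieldNormedType.Exports.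
Local Open Scope classical_set_scope.
Local Open Scope ring_scope.

(** [E] is the intersection of its open neighbourhoods of radius 1/(n+1): a point in all of them is
    a limit of points of [E]. *)
Lemma closed_Gdelta (R : realType) (V : pseudoMetricNormedZmodType R)
    (E : set V) :
  closed E -> Gdelta E.
Proof.
move=> cE; exists (fun n => \bigcup_(e in E) ball e n.+1%:R^-1).
  move=> n; apply: bigcup_open => e _.
  by apply: ball_open; rewrite invr_gt0.
apply/seteqP; split=> [y Ey n _|y Ey].
  by exists y => //; apply: ballxx; rewrite invr_gt0.
rewrite (closure_id E).1//= => B /nbhs_ballP[r /= r0 yrB].
have [n _ /(_ n (leqnn n)) /= nr] := near_infty_natSinv_lt (PosNum r0).
have [e Ee ye] := Ey n I.
exists e; split=> //; apply: yrB.
by apply: (le_ball (ltW nr)); apply: ball_sym.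
Qed.

(** Pairing the n-th open set with the complement of [B n] keeps a single sequence of open sets. *)
Lemma GdeltaD_bigcup_closed (T : topologicalType) (E : set T)
    (B : (set T)^nat) :
  Gdelta E -> (forall n, closed (B n)) -> Gdelta (E `\` \bigcup_n B n).
Proof.
move=> [F oF ->] cB; exists (fun n => F n `&` ~` B n).
  by move=> n; apply: openI => //; rewrite openC.
by rewrite setDE setC_bigcup bigcapI.
Qed.

Section subsums.
Context (R : realType) (x : R^nat).
Hypothesis hx : cvgn [normed series x].
Implicit Types (A B : set nat) (y z e : R).

Lemma is_subsum_ex A : exists y, is_subsum x A y.
Proof.
(* Replacing the omitted terms by 0 gives an ordinary series dominated by the absolute values of
   [x]. *)
suff : cvgn (series (fun k => if k \in A then x k else 0)).
  move=> /cvg_ex[y hy]; exists y; apply: cvg_trans hy.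
  by apply: near_eq_cvg; apply: nearW => n; rewrite /series/= [RHS]big_mkcond.
apply: normed_cvg; apply: series_le_cvg hx => [n|n|n] /=; rewrite ?normr_ge0//.
by case: (n \in A); rewrite ?normr0.
Qed.

Lemma is_subsum_unique A y z : is_subsum x A y -> is_subsum x A z -> y = z.
Proof. by move=> Ay Az; apply: cvg_unique Ay Az. Qed.

Lemma norm_tail_lt e : 0 < e ->
  exists N, forall n, (N <= n)%N -> \sum_(N <= k < n) `|x k| < e.
Proof.
move=> e0; have /cvgrPdist_lt/(_ _ e0)[N _ /(_ N (leqnn N)) /= hN] := hx.
exists N => n Nn; apply: le_lt_trans hN.
(* The partial sums of absolute values increase to their limit, so each block starting at [N] is at
   most the limit minus the [N]-th partial sum. *)
rewrite -(sub_series_geq _ Nn) (le_trans _ (ler_norm _))// lerB//.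
by apply: nondecreasing_cvgn_le => //; apply: nondecreasing_series.
Qed.

(** The bound is uniform in [A], which is what continuity of [subsum] needs. The block from [N] to
    [n] is bounded first; letting [n] grow weakens the strict inequality. *)
Lemma is_subsum_dist A y N e :
    (forall n, (N <= n)%N -> \sum_(N <= k < n) `|x k| < e) ->
  is_subsum x A y -> `|\sum_(0 <= k < N | k \in A) x k - y| <= e.
Proof.
move=> hN Ay.
have : `|\sum_(0 <= k < N | k \in A) x k - \sum_(0 <= k < n | k \in A) x k|
    @[n --> \oo] --> `|\sum_(0 <= k < N | k \in A) x k - y|.
  by apply: cvg_norm; apply: cvgB => //; apply: cvg_cst.
move=> h; rewrite -(cvg_lim _ h)//; apply: limr_le; first exact: cvgP h.
exists N => // n /= Nn; rewrite (@big_cat_nat _ _ _ N 0 n)//= opprD addrA subrr.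
rewrite sub0r normrN (le_trans (ler_norm_sum _ _ _))//.
apply: le_trans (ltW (hN n Nn)).
by rewrite big_mkcond/= ler_sum// => k _; case: ifP.
Qed.

(** Under [hx] a sum exists and is unique, so [get] never falls back on its default value. *)
Definition subsum (a : cantor_space) : R := get (is_subsum x [set k | a k]).

Lemma subsumP (a : cantor_space) : is_subsum x [set k | a k] (subsum a).
Proof. by apply: getPex; apply: is_subsum_ex. Qed.

Lemma is_subsumE A y :
  is_subsum x A y <-> subsum (fun k => k \in A) = y.
Proof.
have AE : [set k | k \in A] = A by apply/seteqP; split=> k /=; rewrite inE.
have := @subsumP (fun k => k \in A); rewrite AE => h.
by split=> [Ay|<-//]; exact: is_subsum_unique h Ay.
Qed.

Lemma coord_continuous k : continuous (fun a : cantor_space => a k).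
Proof. exact: (@proj_continuous nat (fun=> bool) k). Qed.

Lemma subsum_continuous : continuous subsum.
Proof.
move=> a; apply/cvgrPdist_le => e e0.
have [N hN] := norm_tail_lt (divr_gt0 e0 (ltr0n R 2)).
(* Agreement with [a] on the first [N] coordinates is a finite intersection of open conditions in
   the product topology. *)
have : \forall b \near (a : cantor_space),
    forall k : 'I_N, (b : cantor_space) k = a k.
  apply: (@filter_forall _ _ (fun (k : 'I_N) (b : cantor_space) => b k = a k)
    _ (nbhs_filter a)).
  move=> k; apply: (@coord_continuous k a [set a k]).
  exact: discrete_set1.
apply: filterS => b ab.
(* The two partial sums up to [N] coincide and cancel, leaving two tails of size at most e/2
   each. *)
have -> : subsum a - subsum b =
  (\sum_(0 <= k < N | k \in [set k | b k]) x k - subsum b) -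
  (\sum_(0 <= k < N | k \in [set k | a k]) x k - subsum a).
  rewrite (_ : \sum_(0 <= k < N | k \in [set k | b k]) x k =
     \sum_(0 <= k < N | k \in [set k | a k]) x k); first by ring.
  rewrite big_nat_cond [RHS]big_nat_cond; apply: eq_bigl => k.
  case: ltnP => //= kN; have /= kab := ab (Ordinal kN).
  by apply/idP/idP; rewrite !inE/= kab.
rewrite (le_trans (ler_normB _ _))// [e]splitr lerD//.
- exact: is_subsum_dist hN (@subsumP b).
- exact: is_subsum_dist hN (@subsumP a).
Qed.

Lemma closed_subsum_coord k (b : bool) :
  closed (subsum @` [set a | a k = b]).
Proof.
apply: compact_closed; first exact: Rhausdorff.
apply: (@continuous_compact cantor_space R subsum [set a | a k = b]).
  by apply: continuous_subspaceT; exact: subsum_continuous.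
rewrite -[X in compact X]setTI; apply: compact_closedI.
  exact: cantor_space_compact.
apply: (@preimage_closed cantor_space bool (fun a => a k) [set b]).
  by move=> *; exact: coord_continuous.
exact: discrete_closed.
Qed.

(** The index 0 is an arbitrary choice; splitting on it lets [closed_subsum_coord] give closedness
    of the whole set. *)
Lemma achievement_setE : achievement_set x =
  subsum @` [set a | a 0 = true] `|` subsum @` [set a | a 0 = false].
Proof.
apply/seteqP; split=> [y [A /is_subsumE Ay]|y].
  by case A0 : (0%N \in A); [left|right]; exists (fun k => k \in A).
by case=> -[a _ <-]; eexists; exact: subsumP.
Qed.

Lemma uniqueness_setE : uniqueness_set x = achievement_set x `\`
  \bigcup_k (subsum @` [set a | a k = true] `&`
             subsum @` [set a | a k = false]).
Proof.
apply/seteqP; split=> y [Ey]; last first.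
  move=> Uy; split=> //; have [A Ay] := Ey; exists A; split=> // B By.
  apply: contrapT => AB; apply: Uy.
  (* Two distinct representations differ at some [k], which puts [y] in the k-th removed set. *)
  have [k kAB] : exists k, (k \in A) != (k \in B).
    apply: contrapT => /forallNP nAB; apply: AB.
    have AB k : (k \in A) = (k \in B) by apply/eqP/negPn/negP; exact: nAB.
    by apply/seteqP; split=> k /mem_set; [rewrite AB|rewrite -AB] => /set_mem.
  move: Ay By => /is_subsumE Ay /is_subsumE By.
  exists k => //; move: kAB.
  case kA : (k \in A); case kB : (k \in B) => // _; split.
  - by exists (fun k => k \in A).
  - by exists (fun k => k \in B).
  - by exists (fun k => k \in B).
  - by exists (fun k => k \in A).
(* Conversely, uniqueness would identify [A] with both [a] and [b], which disagree at [k]. *)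
move=> [A [_ uA]]; split=> // -[k _ [[a /= ak ay] [b /= bk by_]]].
have Aa : A = [set k | a k] by apply: uA; rewrite -ay; exact: subsumP.
have Ab : A = [set k | b k] by apply: uA; rewrite -by_; exact: subsumP.
have : [set k | a k] k by [].
by rewrite -Aa Ab /= bk.
Qed.

End subsums.

Theorem theorem18 (R : realType) (x : R^nat)
  (hx : cvgn [normed series x]) :
  Gdelta (uniqueness_set x).
Proof.
rewrite uniqueness_setE//; apply: GdeltaD_bigcup_closed => [|k].
  apply: closed_Gdelta; rewrite achievement_setE//.
  by apply: closedU; exact: closed_subsum_coord.
by apply: closedI; exact: closed_subsum_coord.
Qed.
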